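(* For each of the subshifts $(X(\mathcal P\, IP(k)),S)$, $(X(\mathcal{LAB}),S)$ and $(X_+(\mathcal{LAB}),S)$ the point measure $\delta_e$ is the unique invariant probability measure, and so $\{e\}$ is the unique minimal subset. In particular, these systems are minCT (they have a unique minimal set, which is a fixed point) and have entropy zero.
   Context: Write $\mathbb N=\{1,2,\dots\}$. An $\mathbb N$-vector is a function $\mathbf m:\mathbb N\to\{0,1,2,\dots\}$ with finite support; $FIN(\mathbb N)$ is the additive monoid of all $\mathbb N$-vectors, with identity $\mathbf 0$ and the pointwise order. A label is a set $\mathcal M\subset FIN(\mathbb N)$ such that $\mathbf 0\le\mathbf m_1\le\mathbf m\in\mathcal M$ implies $\mathbf m_1\in\mathcal M$; $\mathcal{LAB}$ is the set of all labels (including $\emptyset$). Fix an odd integer $b\ge5$ and a partition $\{D_\ell:\ell\in\mathbb N\}$ of $\mathbb N$ into infinite sets with $\min D_\ell<\min D_{\ell+1}$. Define $k:\mathbb Z\to\mathbb Z$ by $k(n)=b^{n-1}$ for $n\ge1$, $k(0)=0$, $k(-n)=-k(n)$. $IP(k)$ (resp. $IP_+(k)$) is the set of sums of finite subsets of $k(\mathbb Z)$ (resp. of $k(\{0,1,2,\dots\})$). Each $t\in IP(k)$ has a unique expansion $t=k(j_1)+\dots+k(j_r)$ with $|j_1|>\dots>|j_r|>0$ ($r=0$ for $t=0$); its length vector $\mathbf r(t)\in FIN(\mathbb N)$ is $\mathbf r(t)_\ell=\#\{i:|j_i|\in D_\ell\}$. For a label $\mathcal M$, $A[\mathcal M]=\{t\in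 IP(k):\mathbf r(t)\in\mathcal M\}$ and $A_+[\mathcal M]=A[\mathcal M]\cap IP_+(k)$. $S$ is the shift on $\{0,1\}^{\mathbb Z}$, $S(x)_t=x_{t+1}$; $\chi(A)$ is the characteristic function of $A\subset\mathbb Z$; $e=\chi(\emptyset)$ is the zero sequence. $X(\mathcal P\,IP(k))$, $X(\mathcal{LAB})$, $X_+(\mathcal{LAB})$ are the smallest closed shift-invariant subsets of $\{0,1\}^{\mathbb Z}$ containing, respectively, all $\chi(A_1)$ with $A_1\subset IP(k)$; all $\chi(A[\mathcal M])$ with $\mathcal M\in\mathcal{LAB}$; all $\chi(A_+[\mathcal M])$ with $\mathcal M\in\mathcal{LAB}$. *)

(* Defs.v *)
From HB Require Import structures.
From mathcomp Require Import all_boot all_order all_algebra.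
From mathcomp Require Import finmap.
From mathcomp Require Import all_classical all_reals all_analysis.

Set Implicit Arguments.
Unset Strict Implicit.
Unset Printing Implicit Defensive.

Import Order.TTheory GRing.Theory Num.Theory.

Local Open Scope classical_set_scope.
Local Open Scope ring_scope.

(** * Topological dynamics *)

(* A system is given by a map [f] on an ambient space [T] together with a
   closed [f]-invariant subset [X] of [T]. *)

Definition invariant_set (T : Type) (f : T -> T) (A : set T) : Prop :=
  f @` A = A.

Definition minimal_set (T : topologicalType) (f : T -> T) (X M : set T) : Prop :=
  [/\ M `<=` X, closed M, M !=set0, invariant_set f M &
      forall N : set T, N `<=` M -> closed N -> N !=set0 ->
        invariant_set f N -> N = M].

Definition minCT (T : topologicalType) (f : T -> T) (X : set T) : Prop :=
  exists x : T, f x = x /\ forall M, minimal_set f X M <-> M = [set x].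

Definition borel (T : ptopologicalType) := g_sigma_algebraType (@open T).

(* Borel probability measures on the closed set [X] are identified with the
   Borel probability measures on the ambient space that give [X] mass 1. *)
Definition invariant_probability (R : realType) (T : ptopologicalType)
    (f : T -> T) (X : set T) (mu : probability (borel T) R) : Prop :=
  mu X = 1%E /\
  forall B : set (borel T), measurable B -> mu (f @^-1` B) = mu B.

(* Measures are compared on measurable sets: the values of a [probability]
   outside the sigma-algebra are irrelevant. *)
Definition unique_invariant_probability (R : realType) (T : ptopologicalType)
    (f : T -> T) (X : set T) (nu : probability (borel T) R) : Prop :=
  invariant_probability f X nu /\
  forall mu : probability (borel T) R, invariant_probability f X mu ->
    forall B : set (borel T), measurable B -> mu B = nu B.

(** Topological entropy by open covers (Adler, Konheim and McAndrew) *)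

Definition open_cover (T : topologicalType) (X : set T) (U : set (set T)) : Prop :=
  U `<=` open /\ X `<=` \bigcup_(A in U) A.

Definition subcover_number (R : realType) (T : Type) (X : set T)
    (U : set (set T)) : \bar R :=
  ereal_inf [set (n%:R)%:E | n in
    [set n : nat | exists V : set (set T),
      [/\ V `<=` U, X `<=` \bigcup_(A in V) A & (V #= `I_n)%card]]].

(* The join of the covers [U], [f^-1 U], ..., [f^-(n-1) U]. *)
Definition iterated_join (T : Type) (f : T -> T) (U : set (set T)) (n : nat) :
    set (set T) :=
  [set \bigcap_(i < n) (iter i f @^-1` A i) |
     A in [set A : nat -> set T | forall i, (i < n)%N -> U (A i)]].

(* By subadditivity the sequence converges for a compact invariant [X], so that
   the upper limit is the limit. *)
Definition cover_entropy (R : realType) (T : Type) (f : T -> T) (X : set T)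
    (U : set (set T)) : \bar R :=
  limn_esup (fun n : nat =>
    ((n%:R : R)^-1)%:E * lne (subcover_number R X (iterated_join f U n)))%E.

Definition topological_entropy (R : realType) (T : topologicalType)
    (f : T -> T) (X : set T) : \bar R :=
  ereal_sup [set cover_entropy R f X U | U in open_cover X].

(** * The full shift and its subshifts *)

Definition full_shift : Type := {ptws int -> bool}.

HB.instance Definition _ := Pointed.on full_shift.
HB.instance Definition _ := Topological.on full_shift.

Definition shift_map (x : full_shift) : full_shift := fun t => x (t + 1).

Definition chi (A : set int) : full_shift := fun t => t \in A.

Definition zero_seq : full_shift := chi set0.

Definition generated_subshift (G : set full_shift) : set full_shift :=
  smallest [set Y | closed Y /\ invariant_set shift_map Y] G.

(** * Labels *)

(* The positive integers that index vectors and blocks [D] are shifted down by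
   one: [m l] is the coordinate of index [l + 1], and [D l] is the block of
   index [l + 1].  The elements of the blocks are not shifted. *)

Definition FIN : set (nat -> nat) := [set m | finite_set [set l | m l != 0%N]].

Definition is_label (M : set (nat -> nat)) : Prop :=
  M `<=` FIN /\
  forall m1 m, M m -> (forall l, (m1 l <= m l)%N) -> M m1.

(** * The expanding sequence *)

(* [Negz n] is [- n.+1]. *)
Definition kfun (b : nat) (n : int) : int :=
  match n with
  | Posz 0 => 0
  | Posz n'.+1 => b%:Z ^+ n'
  | Negz n' => - b%:Z ^+ n'
  end.

Definition finite_sums (A : set int) : set int :=
  [set \sum_(x <- F) x | F in [set F : {fset int} | [set` F] `<=` A]].

Definition IP (b : nat) : set int := finite_sums (range (kfun b)).

Definition IPplus (b : nat) : set int :=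
  finite_sums (kfun b @` [set j | 0 <= j]).

Definition is_expansion (b : nat) (t : int) (s : seq int) : Prop :=
  [/\ sorted (fun i j : int => (`|j| < `|i|)%N) s,
      all (fun j : int => (0 < `|j|)%N) s &
      t = \sum_(j <- s) kfun b j].

(* The default value is irrelevant for [t] in [IP b], where the expansion exists
   and is unique. *)
Definition expansion (b : nat) (t : int) : seq int :=
  xget [::] (is_expansion b t).

Definition length_vector (b : nat) (D : nat -> set nat) (t : int) : nat -> nat :=
  fun l => count (fun j : int => `|j|%N \in D l) (expansion b t).

Definition A_of (b : nat) (D : nat -> set nat) (M : set (nat -> nat)) : set int :=
  [set t | IP b t /\ M (length_vector b D t)].

Definition Aplus_of (b : nat) (D : nat -> set nat) (M : set (nat -> nat)) :
    set int :=
  A_of b D M `&` IPplus b.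

Definition X_PIP (b : nat) : set full_shift :=
  generated_subshift [set chi A | A in [set A | A `<=` IP b]].

Definition X_LAB (b : nat) (D : nat -> set nat) : set full_shift :=
  generated_subshift [set chi (A_of b D M) | M in is_label].

Definition Xplus_LAB (b : nat) (D : nat -> set nat) : set full_shift :=
  generated_subshift [set chi (Aplus_of b D M) | M in is_label].

Definition set_min (A : set nat) : nat := xget 0%N (A `&` lbound A).

(* Main.v *)
Require Import Defs.
From mathcomp Require Import all_boot all_order all_algebra finmap.
From mathcomp Require Import all_classical all_reals all_analysis.
From mathcomp Require Import measurable_realfun.
From mathcomp Require Import zify ring lra.

Set Implicit Arguments.
Unset Strict Implicit.
Unset Printing Implicit Defensive.

Import Order.TTheory GRing.Theory Num.Theory.

Local Open Scope classical_set_scope.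
Local Open Scope ring_scope.

(** The characteristic functions that generate each of the three subshifts are
    supported in [IP b], and [IP b] has upper Banach density zero: an element of
    [IP b] is a digit -1, 0 or 1 plus [b] times another element, so that a window
    of [b ^ n.+1] consecutive integers contains at most three times as many
    elements as the fullest window of length [b ^ n], hence at most [3 ^ n.+1]
    ([ones_chi_IP]). A bound on the number of ones in all windows of a given
    length is a closed and shift invariant condition, so that it passes from the
    generators to the whole subshift: for every [k] some window length is such
    that at most one symbol in [k] is a one ([sparse]).

    All the conclusions hold for every closed, invariant and sparse [X] that
    contains the zero sequence.

    Invariant measures. By invariance, every coordinate equals 1 with the same
    probability [p]. Integrating the number of ones in a window of length [N] gives
    [N * p <= N / k], thus [p = 0] ([sparse_invariant_coordinate]), and the measure
    is carried by the zero sequence.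

    Minimal sets. A sparse point has arbitrarily long windows of zeros, so that its
    orbit accumulates at the zero sequence, which therefore lies in every nonempty
    closed invariant subset ([sparse_zero_seq]).

    Entropy. By compactness an open cover is refined by the cylinders on some
    window [-m, m], so that the [n]-th join has a subcover indexed by words of
    length [n + 2 * m] ([subcover_number_join]). In such words at most one symbol in
    [k] is a one, and there are at most [exp (N * (1 + ln k) / k)] words of length
    [N] with this property ([ln_card_sparse_words]). The exponential growth rate is
    thus at most a multiple of [(1 + ln k) / k] for every [k], that is, zero. *)

(** * Windows and the expanding sequence *)

Definition ones (x : full_shift) (a : int) (N : nat) : nat :=
  (\sum_(i < N) nat_of_bool (x (a + i%:Z)%R))%N.

(** A word is encoded as the set of the positions of its ones, so that its number
    of ones is a cardinal. *)
Definition word (x : full_shift) (a : int) (N : nat) : {set 'I_N} :=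
  [set i : 'I_N | x (a + i%:Z)]%SET.

Lemma ones_card x a N : ones x a N = #|word x a N|.
Proof.
rewrite /ones -sum1_card [RHS]big_mkcond /=.
by apply: eq_bigr => i _; rewrite inE; case: (x _).
Qed.

Lemma onesD x a M N : ones x a (M + N) = (ones x a M + ones x (a + M%:Z) N)%N.
Proof.
rewrite /ones big_split_ord /=; congr (_ + _)%N.
by apply: eq_bigr => i _; rewrite PoszD addrA.
Qed.

Lemma kfun_rec b z :
  [\/ kfun b z = 1, kfun b z = -1 | exists w, kfun b z = b%:Z * kfun b w].
Proof.
case: z => [[|[|n]]|[|n]] /=.
- by apply: Or33; exists 0; rewrite mulr0.
- exact: Or31.
- by apply: Or33; exists n.+1%:Z; rewrite exprS.
- exact: Or32.
- by apply: Or33; exists (Negz n); rewrite /= exprS mulrN.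
Qed.

(** The digit -1, 0 or 1 is encoded by [d : 'I_3] as [d - 1]. In a finite set of
    values of [kfun b] only 1 and -1 can fail to be [b] times another value; the
    rest of the sum is divided by [b]. *)
Lemma IP_digit b t : (0 < b)%N -> IP b t ->
  exists d : 'I_3, exists2 u, IP b u & t = b%:Z * u + (d%:Z - 1).
Proof.
move=> b0 [F Fk <-].
have [G GE kG] : exists2 G, G = ((F `\ 1) `\ -1)%fset &
    forall x, x \in G -> exists2 y, range (kfun b) y & x = b%:Z * y.
  eexists; first by []; move=> x; rewrite !inE => /and3P[xN1 x1 xF].
  have [z _ zx] := Fk x xF.
  have [E|E|[w E]] := kfun_rec b z; rewrite zx in E.
  - by rewrite E eqxx in x1.
  - by rewrite E eqxx in xN1.
  - by exists (kfun b w).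
pose u := \sum_(y <- [fset (x %/ b%:Z)%Z | x in G]%fset) y.
have bN0 : b%:Z != 0 by rewrite eqz_nat -lt0n.
have uIP : IP b u.
  exists [fset (x %/ b%:Z)%Z | x in G]%fset => // y /imfsetP[x /kG[y' ky ->] ->].
  by rewrite /= mulKz.
have sumG : \sum_(x <- G) x = b%:Z * u.
  rewrite /u big_imfset/=; last first.
    move=> x y xG yG; have [x' _ ->] := kG x xG; have [y' _ ->] := kG y yG.
    by rewrite !mulKz // => ->.
  rewrite big_distrr/= !big_seq; apply: eq_bigr => x /kG[y _ ->].
  by rewrite mulKz.
have sumD1 (H : {fset int}) (a : int) :
    \sum_(x <- H) x = (a \in H)%:R * a + \sum_(x <- (H `\ a)%fset) x.
  case: (boolP (a \in H)) => aH; first by rewrite (big_fsetD1 a)//= mul1r.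
  by rewrite mul0r add0r (mem_fsetD1 aH).
rewrite (sumD1 F 1) (sumD1 _ (-1)) -GE sumG.
case: (1 \in F); case: (-1 \in (F `\ 1)%fset).
- by exists (inord 1), u => //; rewrite inordK// ?mulr1n ?mulr0n; lia.
- by exists (inord 2), u => //; rewrite inordK// ?mulr1n ?mulr0n; lia.
- by exists (inord 0), u => //; rewrite inordK// ?mulr1n ?mulr0n; lia.
- by exists (inord 1), u => //; rewrite inordK// ?mulr1n ?mulr0n; lia.
Qed.

(** The points of [IP b] in a window of length [b ^ n.+1] with a given last digit
    correspond to points of [IP b] in a window of length [b ^ n]. *)
Lemma ones_chi_IP b n a : (0 < b)%N -> (ones (chi (IP b)) a (b ^ n) <= 3 ^ n)%N.
Proof.
move=> b0; elim: n a => [|n IH] a.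
  by rewrite expn0 /ones big_ord1; case: (chi _ _).
have bN0 : b%:Z != 0 by rewrite eqz_nat -lt0n.
(* [q d] is the least [u] with [a <= b * u + (d - 1)] *)
pose q (d : 'I_3) : int := - ((d%:Z - 1 - a) %/ b%:Z)%Z.
pose S := [set p : 'I_3 * 'I_(b ^ n) | chi (IP b) (q p.1 + p.2%:Z)]%SET.
(* recovers a position from its digit and its quotient; the default value of
   [insubd] is only met at pairs whose point lies outside of the window *)
pose f (p : 'I_3 * 'I_(b ^ n)) : 'I_(b ^ n.+1) :=
  insubd (Ordinal (etrans (expn_gt0 b n.+1) (introT orP (or_introl b0))))
    `|(b%:Z * (q p.1 + p.2%:Z) + (p.1%:Z - 1) - a)%R|%N.
rewrite ones_card; apply: (@leq_trans #|f @: S|).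
  apply/subset_leq_card/fintype.subsetP => i; rewrite inE /chi => /set_mem.
  move=> /(IP_digit b0)[d [u uIP tE]].
  have rge := modz_ge0 (d%:Z - 1 - a) bN0.
  have rlt := ltz_pmod (d%:Z - 1 - a) (b0 : 0 < b%:Z).
  have dE := divz_eq (d%:Z - 1 - a) b%:Z.
  have iE : i%:Z = b%:Z * (u - q d) + ((d%:Z - 1 - a) %% b)%Z.
    rewrite /q; move: dE tE; set r := (_ %% _)%Z; set w := (_ %/ _)%Z.
    by move=> dE tE; lia.
  have uq0 : 0 <= u - q d.
    have : b%:Z * -1 < b%:Z * (u - q d).
      by move: rlt iE; move: (_ %% _)%Z (b%:Z * (u - q d)) => r w; lia.
    by rewrite ltr_pM2l //; lia.
  have uqn : u - q d < (b ^ n)%:Z.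
    rewrite -(ltr_pM2l (b0 : 0 < b%:Z)) -PoszM -expnS.
    have := ltn_ord i; move: rge iE; move: (_ %% _)%Z (b%:Z * (u - q d)) => r w.
    by lia.
  have lt : (`|(u - q d)%R| < b ^ n)%N by lia.
  apply/imsetP; exists (d, Ordinal lt).
    by rewrite inE /= gez0_abs // addrC subrK /chi; apply/mem_set.
  apply: val_inj; rewrite val_insubd /= gez0_abs //.
  have -> : (b%:Z * (q d + (u - q d)) + (d%:Z - 1) - a) = i%:Z.
    by rewrite addrC; move: tE; lia.
  by rewrite absz_nat ltn_ord.
apply: leq_trans (leq_imset_card _ _) _.
have -> : #|S| = (\sum_(d < 3) ones (chi (IP b)) (q d) (b ^ n))%N.
  rewrite -sum1_card [LHS]big_mkcond /= /ones.
  rewrite (pair_big xpredT xpredT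
    (fun (d : 'I_3) (j : 'I_(b ^ n)) =>
      nat_of_bool (chi (IP b) (q d + j%:Z)%R))) /=.
  by apply: eq_bigr => p _; rewrite inE; case: (chi _ _).
rewrite expnS -[X in (X * _)%N](card_ord 3) -sum_nat_const.
by apply: leq_sum => d _.
Qed.

(** * Topology of the full shift *)

Definition cylinder (x : full_shift) (m : nat) : set full_shift :=
  [set y | forall t : int, (`|t| <= m)%N -> y t = x t].

Lemma cylinderS x m n : (m <= n)%N -> cylinder x n `<=` cylinder x m.
Proof. by move=> mn y xy t tm; apply: xy; exact: leq_trans mn. Qed.

Lemma nbhs_coordinate (x : full_shift) t : nbhs x [set y : full_shift | y t = x t].
Proof.
have xt : nbhs (x t) [set x t] by rewrite nbhs_principalE.
exact: (@proj_continuous int (fun=> bool) t x _ xt).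
Qed.

Lemma cylinder_nbhs x m : nbhs x (cylinder x m).
Proof.
elim: m => [|m IH].
  apply: filterS (nbhs_coordinate x 0) => y xy t.
  by rewrite leqn0 absz_eq0 => /eqP ->.
apply: filterS (filterI IH (filterI (nbhs_coordinate x m.+1)
  (nbhs_coordinate x (- m.+1%:Z)))) => y [xy [yp yn]] t.
rewrite leq_eqVlt => /orP[/eqP tm|]; last exact: xy.
by case: t tm => n /= tm; [rewrite tm|rewrite NegzE tm].
Qed.

(** The filter generated by the cylinders around [x] converges to [x] because it
    does so at each coordinate, and therefore refines the neighbourhoods. *)
Lemma nbhs_cylinder (x : full_shift) (A : set full_shift) :
  nbhs x A -> exists m, cylinder x m `<=` A.
Proof.
move=> xA.
pose F := filter_from [set: nat] (cylinder x).
have FF : Filter F.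
  apply: filter_from_filter; first by exists 0%N.
  move=> i j _ _; exists (maxn i j) => // y xy.
  by split; move: y xy; apply: cylinderS; rewrite ?leq_maxl ?leq_maxr.
suff /(_ A xA)[m _ mA] : F --> x by exists m.
apply/cvg_sup => t; apply/cvg_image => //.
  by apply/seteqP; split=> // y _; exists (fun=> y).
move=> B /nbhs_singleton Bxt; exists [set f | B (f t)].
  by exists `|t|%N => // y /(_ t (leqnn _)) /= ->.
apply/seteqP; split=> [_ [f Bf <-]//|c Bc].
by exists (fun=> c).
Qed.

Lemma closed_cylinder (A : set full_shift) (y : full_shift) :
  closed A -> (forall m, exists2 z, A z & cylinder y m z) -> A y.
Proof.
move=> clA yA; apply: clA => B /nbhs_cylinder[m mB].
by have [z Az /mB Bz] := yA m; exists z.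
Qed.

Lemma full_shift_compact : compact [set: full_shift].
Proof.
have := @tychonoff int (fun=> bool) (fun=> setT) (fun=> bool_compact).
by congr compact; apply/seteqP; split.
Qed.

Lemma shift_inv_setP (A : set full_shift) :
  invariant_set shift_map A <-> forall x, A (shift_map x) <-> A x.
Proof.
have shift_surj (x : full_shift) : x = shift_map (fun t => x (t - 1)).
  by apply/funext => t; rewrite /shift_map addrK.
have shift_inj : injective shift_map.
  move=> x y /(congr1 (fun z : full_shift => z (_ - 1))) xy.
  by apply/funext => t; have := xy t; rewrite /shift_map subrK.
split=> [AA x|AA]; first split.
- by rewrite -{1}AA => -[y Ay /shift_inj <-].
- by move=> Ax; rewrite -AA; exists x.
- apply/seteqP; split=> [_ [x Ax <-]|x Ax]; first exact/AA.
  by exists (fun t => x (t - 1)); last rewrite -shift_surj //; apply/AA;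
    rewrite -shift_surj.
Qed.

Lemma generated_subshift_closed G : closed (generated_subshift G).
Proof. by apply: closed_bigI => Y [[]]. Qed.

Lemma generated_subshift_inv G : invariant_set shift_map (generated_subshift G).
Proof.
apply/shift_inv_setP => x; split=> Gx Y GY; have [[_ /shift_inv_setP YY] _] := GY;
  apply/YY; exact: Gx.
Qed.

Lemma ones_shift x a N : ones (shift_map x) a N = ones x (a + 1) N.
Proof. by apply: eq_bigr => i _; rewrite /shift_map addrAC. Qed.

Lemma ones_le_closed a N c : closed [set x : full_shift | (ones x a N <= c)%N].
Proof.
move=> y clA; have [z [zA yz]] := clA _ (cylinder_nbhs y (`|a|%N + N)%N).
suff E : ones z a N = ones y a N by move: zA; rewrite /= E.
by apply: eq_bigr => i _; rewrite yz //; have := ltn_ord i; lia.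
Qed.

Lemma ones_generated (G : set full_shift) N c :
  (forall x, G x -> forall a, (ones x a N <= c)%N) ->
  forall x, generated_subshift G x -> forall a, (ones x a N <= c)%N.
Proof.
move=> Gc x Gx.
apply: (Gx [set x | forall a, (ones x a N <= c)%N]); split => //; split.
  have -> : [set x | forall a, (ones x a N <= c)%N] =
      \bigcap_(a in [set: int]) [set x | (ones x a N <= c)%N].
    by apply/seteqP; split=> y yc a => [_|]; exact: yc.
  by apply: closed_bigI => a _; exact: ones_le_closed.
apply/shift_inv_setP => y; split=> yc a.
  by rewrite -(subrK 1 a) -ones_shift.
by rewrite ones_shift.
Qed.

(** * Sparse subshifts *)

(** Zero upper Banach density of the ones, uniformly over [X]. *)
Definition sparse (X : set full_shift) : Prop :=
  forall k, exists2 N, (0 < N)%N &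
    forall x, X x -> forall a, (k * ones x a N <= N)%N.

(** With [3 ^ n] ones at most in windows of length [b ^ n], it remains to make
    [(b / 3) ^ n] larger than [k]; the exponent [k] is large enough. *)
Lemma generated_sparse b (G : set full_shift) : (5 <= b)%N ->
  (forall x, G x -> forall t, x t -> IP b t) -> sparse (generated_subshift G).
Proof.
move=> b5 GIP k; have b0 : (0 < b)%N by lia.
have k3b : (k * 3 ^ k <= b ^ k)%N.
  elim: k => // k IH; case: (posnP k) => [->|k0]; first by rewrite !expn1; lia.
  case: (eqVneq k 1%N) => [->|k1]; first by rewrite !expnS !expn0; nia.
  rewrite !expnS; apply: (@leq_trans (5 * (k * 3 ^ k))); last exact: leq_mul.
  by rewrite mulnA [in leqRHS]mulnA leq_mul2r; lia.
exists (b ^ k)%N; first by rewrite expn_gt0 b0.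
move=> x Gx a; apply: leq_trans k3b; rewrite leq_mul2l; apply/orP; right.
apply: (ones_generated _ Gx) => {Gx a} x Gx a.
apply: leq_trans (ones_chi_IP k a b0); apply: leq_sum => i _.
case: (boolP (x _)) => // /(GIP x Gx) IPx.
by rewrite /chi mem_set.
Qed.

(** A long window is covered by windows of the length given by [sparse] for
    [2 * k]; the factor 2 absorbs the excess of the last of them. *)
Lemma sparse_large X : sparse X -> forall k, exists N0, forall N, (N0 <= N)%N ->
  forall x, X x -> forall a, (k * ones x a N <= N)%N.
Proof.
move=> sX k; have [L L0 XL] := sX (2 * k)%N; exists L => N LN x Xx a.
have XLs s c : (2 * k * ones x c (s * L) <= s * L)%N.
  elim: s c => [|s IH] c; first by rewrite mul0n /ones big_ord0 muln0.
  by rewrite mulSn onesD mulnDr leq_add // XL.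
have NsL : (N <= (N %/ L).+1 * L)%N by rewrite ltnW // ltn_ceil.
have := XLs (N %/ L).+1 a; rewrite -(subnKC NsL) onesD subnKC //.
have := leq_trunc_div N L; rewrite mulSn; nia.
Qed.

(** Double counting: if each of the [N] windows of length [m] that start at
    0, ..., N - 1 contained a one, then the windows of length [N] that start at
    0, ..., m - 1 would contain at least [N] ones altogether, while sparseness
    allows [m * N / m.+1]. *)
Lemma sparse_zero_window X x m : sparse X -> X x ->
  exists i : nat, forall j, (j < m)%N -> x (i%:Z + j%:Z) = false.
Proof.
move=> sX Xx; have [N N0 XN] := sX m.+1.
apply: contrapT => noW.
have hit (i : nat) : (0 < \sum_(j < m) x (i%:Z + j%:Z)%R)%N.
  rewrite lt0n; apply/negP; rewrite sum_nat_eq0 => /forallP s0.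
  apply: noW; exists i => j jm.
  by have := s0 (Ordinal jm); rewrite /= eqb0 => /negbTE.
have : (m.+1 * N <= m * N)%N.
  rewrite -[X in (_ * X <= _)%N]card_ord -[X in (_ <= X * _)%N]card_ord.
  rewrite -sum1_card -sum_nat_const.
  apply: (@leq_trans (m.+1 * \sum_(i < N) \sum_(j < m) x (i%:Z + j%:Z)%R)).
    by rewrite leq_mul2l /=; apply: leq_sum => i _; exact: hit.
  rewrite exchange_big big_distrr /=; apply: leq_sum => j _.
  apply: leq_trans (XN x Xx j%:Z); rewrite leq_mul2l /=.
  by apply: leq_sum => i _; rewrite addrC.
by rewrite leq_pmul2r // ltnn.
Qed.

Lemma iter_shiftE n (x : full_shift) t : iter n shift_map x t = x (t + n%:Z).
Proof.
elim: n t => [|n IH] t; first by rewrite addr0.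
by rewrite iterS {1}/shift_map IH -addrA -PoszD add1n.
Qed.

Lemma iter_shift_in (X : set full_shift) n x :
  invariant_set shift_map X -> X x -> X (iter n shift_map x).
Proof. by move=> /shift_inv_setP XX Xx; elim: n => // n IH; apply/XX. Qed.

Lemma zero_seqE t : zero_seq t = false.
Proof. by rewrite /zero_seq /chi in_set0. Qed.

Lemma shift_zero_seq : shift_map zero_seq = zero_seq.
Proof. by apply/funext => t; rewrite /shift_map !zero_seqE. Qed.

(** Shifting to the centre of a window of [2 * m + 1] zeros gives a point of [M]
    that agrees with the zero sequence on [-m, m]. *)
Lemma sparse_zero_seq X M : sparse X -> M `<=` X -> closed M -> M !=set0 ->
  invariant_set shift_map M -> M zero_seq.
Proof.
move=> sX MX clM [x Mx] Minv; apply: closed_cylinder => // m.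
have [i xi] := sparse_zero_window (m + m).+1 sX (MX _ Mx).
exists (iter (i + m) shift_map x); first exact: iter_shift_in.
move=> t tm; rewrite iter_shiftE zero_seqE.
have <- : i%:Z + `|(t + m%:Z)%R|%N%:Z = t + (i + m)%N%:Z by lia.
by apply: xi; lia.
Qed.

Lemma closed_zero_seq : closed [set zero_seq].
Proof.
move=> y cly; apply/funext => t.
by have [z [-> /= ->]] := cly _ (nbhs_coordinate y t).
Qed.

Lemma sparse_minimal X : sparse X -> X zero_seq -> forall M,
  minimal_set shift_map X M <-> M = [set zero_seq].
Proof.
move=> sX X0 M.
have inv0 : invariant_set shift_map [set zero_seq].
  by rewrite /invariant_set image_set1 shift_zero_seq.
split=> [[MX clM M0 invM minM]|->].
  have M0s := sparse_zero_seq sX MX clM M0 invM.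
  apply/esym/minM => //; [by move=> _ ->|exact: closed_zero_seq|by exists zero_seq].
split=> //; [by move=> _ ->|exact: closed_zero_seq|by exists zero_seq|].
move=> N N0 clN Nn0 invN; apply/seteqP; split=> // _ ->.
by apply: (sparse_zero_seq sX) => // y /N0 ->.
Qed.

(** * Invariant measures *)

Definition coordinate (t : int) : set (borel full_shift) :=
  [set x : full_shift | x t].

Lemma open_measurable_borel (A : set (borel full_shift)) :
  open (A : set full_shift) -> measurable A.
Proof. by move=> oA; exact: sub_gen_smallest. Qed.

Lemma measurable_coordinate t : measurable (coordinate t).
Proof.
apply: open_measurable_borel; rewrite openE => x xt.
by apply: filterS (nbhs_coordinate x t) => y yt; exact: etrans yt xt.
Qed.

Section invariant_measures.
Context (R : realType).

(** All the coordinates have the same measure [p]; integrating over [X] the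
    number of ones in a window of length [N] gives [N * p <= N / k.+1]. *)
Lemma sparse_invariant_coordinate X (mu : probability (borel full_shift) R) t :
  sparse X -> closed X -> invariant_probability shift_map X mu ->
  mu (coordinate t) = 0%E.
Proof.
move=> sX clX [muX muS].
have mX : measurable (X : set (borel full_shift)).
  rewrite -[X]setCK; apply: measurableC; apply: open_measurable_borel.
  exact: closed_openC.
have mu_succ s : mu (coordinate (s + 1)) = mu (coordinate s).
  by rewrite -(muS _ (measurable_coordinate s)).
have mu_t s : mu (coordinate s) = mu (coordinate t).
  have mu_0 u : mu (coordinate u) = mu (coordinate 0).
    case: u => n; elim: n => [//|n IH].
    - by rewrite -addn1 PoszD mu_succ.
    - by rewrite -mu_succ.
    - by rewrite -mu_succ (_ : Negz n.+1 + 1 = Negz n) //; lia.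
  by rewrite !mu_0.
have mu_XI (A : set (borel full_shift)) : measurable A ->
    mu (A `&` (X : set (borel full_shift))) = mu A.
  move=> mA.
  have muXC : mu (~` (X : set (borel full_shift))) = 0%E.
    by rewrite probability_setC // muX subee.
  rewrite -[in RHS](setIT A) -(setUv X) setIUr measureU0 //.
  - exact: measurableI.
  - by apply: measurableI => //; exact: measurableC.
  - apply: (subset_measure0 _ _ (@subIsetr _ A (~` X))) => //.
      by apply: measurableI => //; exact: measurableC.
    exact: measurableC.
have mA := measurable_coordinate.
pose p := fine (mu (coordinate t)).
have pE : mu (coordinate t) = p%:E by rewrite fineK // fin_num_measure.
have int_coord s : (\int[mu]_(x in X) (\1_(coordinate s) x)%:E = p%:E)%E.
  by rewrite integral_indic // -pE -(mu_t s); exact: mu_XI.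
have int_cst (r : R) : (\int[mu]_(x in X) r%:E = r%:E)%E.
  by rewrite (integral_cst mu mX) -[RHS]mule1 -muX.
have p_le k : k.+1%:R * p <= 1.
  have [N N0 XN] := sX k.+1.
  have sum_ones x : \sum_(i < N) \1_(coordinate i%:Z) x = (ones x 0 N)%:R :> R.
    rewrite /ones natr_sum; apply: eq_bigr => i _.
    rewrite indicE add0r; congr (nat_of_bool _)%:R.
    by apply/idP/idP => [/set_mem|/mem_set].
  have : (\int[mu]_(x in X) \sum_(i < N) (\1_(coordinate i%:Z) x)%:E
           <= \int[mu]_(x in X) (N%:R / k.+1%:R)%:E)%E.
    apply: ge0_le_integral => //.
    - by move=> x _; apply: sume_ge0 => i _; rewrite lee_fin.
    - apply: emeasurable_sum => i; apply/measurable_EFinP; exact: measurable_indic.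
    - move=> x Xx; rewrite sumEFin lee_fin sum_ones ler_pdivlMr ?ltr0n //.
      by rewrite -natrM ler_nat mulnC XN.
  rewrite ge0_integral_sum //; last first.
    by move=> i; apply/measurable_EFinP; exact: measurable_indic.
  under eq_bigr => i _ do rewrite int_coord.
  rewrite int_cst sumEFin lee_fin sumr_const card_ord.
  rewrite ler_pdivlMr ?ltr0n // -[p *+ N]mulr_natl -mulrA [p * _]mulrC.
  by rewrite -[X in _ <= X]mulr1 ler_pM2l ?ltr0n.
have p0 : 0 <= p by rewrite fine_ge0.
rewrite pE; congr (_%:E); apply/eqP.
rewrite eq_le p0 andbT leNgt; apply/negP => pgt0.
have := p_le (Num.truncn p^-1); rewrite leNgt => /negP; apply.
by rewrite -ltr_pdivrMr // mul1r truncnS_gt.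
Qed.

(** The complement of the zero sequence is the countable union of the
    coordinates, which are null. *)
Lemma sparse_unique_invariant X :
  sparse X -> closed X -> X zero_seq ->
  unique_invariant_probability shift_map X
    (dirac (zero_seq : borel full_shift) : probability (borel full_shift) R).
Proof.
move=> sX clX X0; split.
  split=> [|B mB]; first by rewrite /= diracE mem_set.
  have B0 : B (shift_map zero_seq) = B zero_seq by rewrite shift_zero_seq.
  rewrite /= !diracE; have [B1|B1] := pselect (B zero_seq).
    by rewrite !mem_set //; change (B (shift_map zero_seq)); rewrite B0.
  by rewrite !memNset //; change (~ B (shift_map zero_seq)); rewrite B0.
move=> mu muinv.
have null_neg t : mu.-negligible (coordinate t).
  apply/negligibleP; first exact: measurable_coordinate.
  exact: sparse_invariant_coordinate muinv.
have null : mu.-negligible (~` [set zero_seq] : set (borel full_shift)).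
  apply: (@negligibleS _ _ _ mu
    (\bigcup_n (coordinate n%:Z `|` coordinate (- n%:Z)))).
    move=> x; apply: contra_notP => nx; apply/funext => t; rewrite zero_seqE.
    apply/negbTE/negP => xt; apply: nx; exists `|t|%N => //.
    have [t0|t0] := leP 0 t; first by left; rewrite gez0_abs.
    by right; rewrite ltz0_abs // opprK.
  by apply: negligible_bigcup => n; exact: negligibleU.
have muN (B : set (borel full_shift)) : measurable B -> ~ B zero_seq -> mu B = 0%E.
  move=> mB B0; apply/negligibleP => //; apply: negligibleS null => x Bx x0.
  by apply: B0; rewrite -x0.
move=> B mB; rewrite /= diracE; have [B0|B0] := pselect (B zero_seq).
  rewrite mem_set //; have := probability_setC mu (measurableC mB).
  by rewrite setCK (muN (~` B)) ?sube0 //; exact: measurableC.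
by rewrite memNset // muN.
Qed.

End invariant_measures.

(** * Topological entropy *)

Definition sparse_words k N := [set w : {set 'I_N} | (k * #|w| <= N)%N]%SET.

(** Weigh each word by [k] to the number of its zeros: the total weight is
    [k.+1 ^ N], and sparse words have weight at least [k ^ (N - N %/ k)]. *)
Lemma card_sparse_words k N : (0 < k)%N ->
  (#|sparse_words k N| * k ^ (N - N %/ k) <= k.+1 ^ N)%N.
Proof.
move=> k0.
have -> : (k.+1 ^ N = \sum_(w : {set 'I_N}) k ^ (N - #|w|))%N.
  rewrite -[in LHS](card_ord N) -prod_nat_const.
  under eq_bigr => i _ do rewrite -add1n.
  rewrite bigA_distr; apply: eq_bigr => w _.
  have -> : (N - #|w| = #|~: w|)%N by rewrite [in RHS]cardsCs finset.setCK card_ord.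
  rewrite (bigID (mem w)) /= big1 => [|i ->//]; rewrite mul1n.
  rewrite (eq_bigr (fun=> k)) => [|i /negbTE-> //].
  by rewrite prod_nat_const -cardsE; congr (k ^ _)%N.
rewrite -sum_nat_const big_mkcond /=; apply: leq_sum => w _.
case: ifPn => //; rewrite inE => kw; rewrite leq_pexp2l // leq_sub2l //.
by rewrite leq_divRL // mulnC.
Qed.

Lemma ln_card_sparse_words (R : realType) k N : (0 < k)%N ->
  ln (#|sparse_words k N|%:R : R) <= N%:R * ((1 + ln k%:R) / k%:R).
Proof.
move=> k0; have kR : 0 < k%:R :> R by rewrite ltr0n.
have W0 : (0 < #|sparse_words k N|)%N.
  by apply/card_gt0P; exists finset.set0; rewrite inE cards0 muln0.
have lnk0 : 0 <= ln k%:R :> R by rewrite ln_ge0 // ler1n.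
have := card_sparse_words N k0; rewrite -(ler_nat R) natrM !natrX => cardW.
have : ln (#|sparse_words k N|%:R * k%:R ^+ (N - N %/ k)) <=
       ln (k.+1%:R ^+ N) :> R.
  by rewrite ler_ln // posrE ?mulr_gt0 ?exprn_gt0 ?ltr0n.
rewrite lnM ?posrE ?exprn_gt0 ?ltr0n // !lnXn ?ltr0n //.
have -> : k.+1%:R = k%:R * (1 + k%:R^-1) :> R.
  by rewrite mulrDr mulr1 divff ?gt_eqF // -natr1.
have kV0 : 0 < k%:R^-1 :> R by rewrite invr_gt0.
rewrite lnM ?posrE ?addr_gt0 //.
have lnle : ln (1 + k%:R^-1) <= k%:R^-1 :> R.
  by apply: le_ln1Dx; exact: lt_trans kV0.
rewrite -[ln _ *+ (N - _)]mulr_natl -[(_ + _) *+ N]mulr_natl.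
rewrite natrB ?leq_div //.
have Nk : (N %/ k)%:R <= N%:R * k%:R^-1 :> R.
  by rewrite ler_pdivlMr // -natrM ler_nat leq_trunc_div.
have N0 : 0 <= N%:R :> R by [].
have := ler_wpM2l N0 lnle; have := ler_wpM2r lnk0 Nk.
by move=> le1 le2 le3; lra.
Qed.

(** The Lebesgue number lemma, with cylinders instead of balls. *)
Lemma lebesgue_number X (U : set (set full_shift)) : compact X -> open_cover X U ->
  exists m, forall x, X x -> exists2 A, U A & cylinder x m `<=` A.
Proof.
move=> /compact_near_coveringP cX [Uo XU].
have [] := cX nat \oo (fun m x => exists2 A, U A & cylinder x m `<=` A) _.
  move=> x Xx; have [A UA Ax] := XU x Xx.
  have [m mA] := nbhs_cylinder (open_nbhs_nbhs (conj (Uo A UA) Ax)).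
  exists (cylinder x m, [set n | (m <= n)%N]) => /=.
    by split; [exact: cylinder_nbhs|exists m].
  move=> [y n] /= [xy mn]; exists A => // z yz; apply: mA => t tm.
  by rewrite (yz t (leq_trans tm mn)) xy.
by move=> m _ /(_ m (leqnn m)) mX; exists m => x Xx; exact: mX.
Qed.

Section entropy.
Context (R : realType).
Local Open Scope ereal_scope.

Lemma subcover_number_ge1 (T : Type) (X : set T) U :
  X !=set0 -> 1 <= subcover_number R X U.
Proof.
move=> [x Xx]; apply: le_ereal_inf_tmp => _ [[|n] [V [_ XV Vn]] <-].
  by move: Vn XV; rewrite II0 card_eq0 => /eqP -> /(_ x Xx)[].
by rewrite lee_fin ler1n.
Qed.

(** Two points with the same word on [-m, n + m) have their first [n] iterates in
    common cylinders on [-m, m]; choosing one point of [X] for each word thus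
    chooses an element of the join that contains all the points with that word. *)
Lemma subcover_number_join X (U : set (set full_shift)) m n
    (S : {set {set 'I_(n + m.*2)}}) :
  invariant_set shift_map X ->
  (forall x, X x -> exists2 A, U A & cylinder x m `<=` A) ->
  (forall x, X x -> word x (- m%:Z) (n + m.*2) \in S) ->
  subcover_number R X (iterated_join shift_map U n) <= #|S|%:R%:E.
Proof.
move=> invX XU XS.
have /choice[c cP] : forall x, exists A : set full_shift,
    X x -> U A /\ cylinder x m `<=` A.
  move=> x; have [Xx|nXx] := pselect (X x); last by exists set0.
  by have [A UA xA] := XU x Xx; exists A.
pose g x := \bigcap_(i < n) (iter i shift_map @^-1` c (iter i shift_map x)).
pose W j :=
  [set x | X x /\ word x (- m%:Z) (n + m.*2) = nth finset.set0 (enum S) j].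
pose V := [set g (xget point (W j)) | j in [set j | (j < #|S|)%N /\ W j !=set0]].
have VI : (V #<= `I_#|S|)%card.
  by apply: card_le_trans (card_image_le _ _) _; apply: subset_card_le => j [].
have /finite_setP[k Vk] : finite_set V by apply/finite_set_leP; exists #|S|.
apply: (@le_trans _ _ k%:R%:E); last first.
  by rewrite lee_fin ler_nat -card_le_II -(card_le_eql Vk).
apply: ereal_inf_lbound; exists k => //; exists V; split=> //.
  move=> _ [j [_ [y Wy]] <-].
  have [Xz _] := @xgetPex _ point (W j) (ex_intro _ y Wy).
  exists (fun i => c (iter i shift_map (xget point (W j)))) => //.
  by move=> i _; have [] := cP _ (iter_shift_in i invX Xz).
move=> x Xx.
pose j := index (word x (- m%:Z) (n + m.*2)) (enum S).
have wS : word x (- m%:Z) (n + m.*2) \in enum S by rewrite mem_enum XS.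
have Wx : W j x by split => //; rewrite nth_index.
exists (g (xget point (W j))).
  by exists j => //; split; [rewrite cardE index_mem|exists x].
have [Xz zE] := @xgetPex _ point (W j) (ex_intro _ x Wx).
move=> i /= lein; have [_] := cP _ (iter_shift_in i invX Xz).
apply=> t tm; rewrite !iter_shiftE.
have lt : (`|(t + i%:Z + m%:Z)%R| < n + m.*2)%N by lia.
have tE : (t + i%:Z = - m%:Z + (Ordinal lt)%:Z)%R by rewrite /=; lia.
rewrite tE; have := Wx.2; rewrite -zE => /finset.setP/(_ (Ordinal lt)).
by rewrite !inE.
Qed.

Lemma sparse_cover_entropy X U : sparse X -> compact X -> X !=set0 ->
  invariant_set shift_map X -> open_cover X U -> cover_entropy R shift_map X U = 0.
Proof.
move=> sX cX X0 invX XU.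
have sub_ge1 n := subcover_number_ge1 (iterated_join shift_map U n) X0.
apply/eqP; rewrite eq_le; apply/andP; split; last first.
  apply: limf_esup_ge0; first by case=> n _ /(_ n (leqnn n)).
  by move=> n; rewrite mule_ge0 ?lee_fin ?invr_ge0 // lne_ge0.
apply/lee_addgt0Pr => e e0; rewrite add0e.
have [m mX] := lebesgue_number cX XU.
(* with [k = j ^ 2], [1 + ln k = 1 + 2 * ln j <= 3 * j], so that the growth rate
   is at most [2 * (3 * j) / j ^ 2 = 6 / j]; the factor 2 bounds
   [(n + 2 * m) / n] *)
pose j := (Num.truncn (6 / e)%R).+1.
have j6 : (6 / j%:R <= e :> R)%R.
  by rewrite ler_pdivrMr ?ltr0n // mulrC -ler_pdivrMr // ltW // truncnS_gt.
have j0 : (0 < j%:R :> R)%R by rewrite ltr0n.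
have [N0 XN0] := sparse_large sX (j ^ 2).
apply: (@le_trans _ _ (ereal_sup [set (n%:R^-1)%:E *
    lne (subcover_number R X (iterated_join shift_map U n)) |
      n in [set n | (N0 + m.*2.+1 <= n)%N]])).
  apply: ereal_inf_lbound; exists [set n | (N0 + m.*2.+1 <= n)%N] => //.
  by exists (N0 + m.*2.+1)%N.
apply: ge_ereal_sup => _ [n /= nN <-].
have n0 : (0 < n%:R :> R)%R by rewrite ltr0n; lia.
have k0 : (0 < j ^ 2)%N by rewrite expn_gt0.
set W := sparse_words (j ^ 2) (n + m.*2).
have subW : subcover_number R X (iterated_join shift_map U n) <= #|W|%:R%:E.
  apply: (subcover_number_join invX mX) => x Xx.
  by rewrite inE -ones_card XN0 //; lia.
have W1 : (1 <= #|W|%:R :> R)%R by rewrite -lee_fin (le_trans (sub_ge1 n)).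
apply: (@le_trans _ _ ((n%:R^-1)%:E * lne #|W|%:R%:E)).
  apply: lee_wpmul2l; first by rewrite lee_fin invr_ge0 ltW.
  rewrite lee_lne // in_itv /= leey andbT.
    exact: le_trans (sub_ge1 n).
  by rewrite lee_fin.
rewrite lne_EFin ?(lt_le_trans ltr01) // -EFinM lee_fin.
rewrite ler_pdivrMl //; apply: le_trans (ln_card_sparse_words R _ k0) _.
apply: (@le_trans _ _ ((2 * n%:R) * (3 / j%:R)))%R; last first.
  have -> : (2 * n%:R * (3 / j%:R) = n%:R * (6 / j%:R) :> R)%R by ring.
  by rewrite ler_pM2l.
apply: ler_pM => //.
- by rewrite divr_ge0 // addr_ge0 // ln_ge0 // ler1n.
- by rewrite -natrM ler_nat; lia.
- rewrite natrX lnXn // ler_pdivrMr ?exprn_gt0 //.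
  have -> : (3 / j%:R * j%:R ^+ 2 = 3 * j%:R :> R)%R by field; rewrite gt_eqF.
  have := ln_sublinear j0; have : (1 <= j%:R :> R)%R by rewrite ler1n.
  by rewrite mulr2n; lra.
Qed.

Lemma sparse_entropy X : sparse X -> compact X -> X !=set0 ->
  invariant_set shift_map X -> topological_entropy R shift_map X = 0.
Proof.
move=> sX cX X0 invX; apply/eqP; rewrite eq_le; apply/andP; split.
  by apply: ge_ereal_sup => _ [U XU <-]; rewrite sparse_cover_entropy.
have XT : open_cover X [set setT].
  by split=> [_ ->|x _]; [exact: openT|exists setT].
apply: ereal_sup_ubound; exists [set setT] => //.
by rewrite sparse_cover_entropy.
Qed.

End entropy.

(** * Subshifts generated by subsets of the finite sums *)

Lemma sparse_generated_conclusions (R : realType) b (G : set full_shift) :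
  (5 <= b)%N -> (forall x, G x -> forall t, x t -> IP b t) -> G zero_seq ->
  let X := generated_subshift G in
  [/\ unique_invariant_probability shift_map X
        (dirac (zero_seq : borel full_shift) : probability (borel full_shift) R),
      forall M : set full_shift,
        minimal_set shift_map X M <-> M = [set zero_seq],
      minCT shift_map X &
      topological_entropy R shift_map X = 0%E].
Proof.
move=> b5 GIP G0 X.
have sX : sparse X by exact: generated_sparse GIP.
have clX : closed X by exact: generated_subshift_closed.
have invX : invariant_set shift_map X by exact: generated_subshift_inv.
have X0 : X zero_seq by move=> Y [_]; exact.
have minX := sparse_minimal sX X0.
split=> //; first exact: sparse_unique_invariant.
  by exists zero_seq; split=> //; exact: shift_zero_seq.
apply: sparse_entropy => //; last by exists zero_seq.
exact: subclosed_compact clX full_shift_compact _.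
Qed.

(** The zero sequence is the generator given by the empty subset of [IP b], and by
    the empty label. *)
Theorem corollary3p17 (R : realType) (b : nat) (D : nat -> set nat)
    (b_odd : odd b) (b_ge5 : (5 <= b)%N)
    (D_partition : partition [set: nat] D [set n : nat | (0 < n)%N])
    (D_infinite : forall l : nat, infinite_set (D l))
    (D_min : forall l : nat, (set_min (D l) < set_min (D l.+1))%N) :
  forall X : set full_shift,
    [\/ X = X_PIP b, X = X_LAB b D | X = Xplus_LAB b D] ->
    [/\ unique_invariant_probability shift_map X
          (dirac (zero_seq : borel full_shift) : probability (borel full_shift) R),
        forall M : set full_shift,
          minimal_set shift_map X M <-> M = [set zero_seq],
        minCT shift_map X &
        topological_entropy R shift_map X = 0%E].
Proof.
have label0 : is_label set0 by split.
have A0 : A_of b D set0 = set0 by apply/seteqP; split=> [t []|].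
move=> X [] ->; apply: (sparse_generated_conclusions R b_ge5).
- by move=> _ [A AIP <-] t /set_mem At; exact: (AIP t At).
- by exists set0.
- by move=> _ [M _ <-] t /set_mem[].
- by exists set0; rewrite // A0.
- by move=> _ [M _ <-] t /set_mem[[]].
- by exists set0; rewrite // /Aplus_of A0 set0I.
Qed.
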